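(* There is a mapping $F$ assigning graphs to loopless graphs such that for every ring $M$ and all loopless graphs $G,H$: $G\to H$ (there is a homomorphism) if and only if there is an $M$-tension-continuous mapping from $F(G)$ to $F(H)$. Moreover $F$ extends to mappings: to every homomorphism $f:G\to H$ is assigned a mapping $F(f):E(F(G))\to E(F(H))$ which is $M$-tension-continuous, and every $M$-tension-continuous mapping $E(F(G))\to E(F(H))$ equals $F(f)$ for some homomorphism $f:G\to H$. (That is, $F$ is an embedding of the category of loopless graphs with homomorphisms into the category of graphs with $M$-tension-continuous mappings.)
   Context: Graphs are finite, with multiple edges allowed; the statement may be read either for directed graphs throughout or for undirected graphs throughout. A ring is associative with unity. A circuit is a connected subgraph in which every vertex is incident with exactly two edge-ends; for directed graphs $C^+$/$C^-$ denote the edges of a circuit traversed forwards/backwards. An $M$-tension on a directed graph $D$ is $\tau:E(D)\to M$ with $\sum_{C^+}\tau=\sum_{C^-}\tau$ for every circuit $C$. A map $f:E(D)\to E(D')$ is $M$-tension-continuous if $\tau\circ f$ is an $M$-tension on $D$ for every $M$-tension $\tau$ on $D'$; for undirected graphs, if this holds for some orientations of both graphs. *)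

(* Defs.v *)
From mathcomp Require Import all_boot ssralg.

Set Implicit Arguments.
Unset Strict Implicit.
Unset Printing Implicit Defensive.

Import GRing.Theory.
Local Open Scope ring_scope.

(* Parallel edges and loops are allowed. *)
Record digraph := DiGraph {
  vert : finType;
  edge : finType;
  src : edge -> vert;
  tgt : edge -> vert }.

(* An edge has two ends, or one (with both of its edge-ends there) if it is
   a loop. *)
Record ugraph := UGraph {
  uvert : finType;
  uedge : finType;
  uends : uedge -> {set uvert};
  uends_card : forall e, (0 < #|uends e| <= 2)%N }.

Definition loopless (D : digraph) : bool := [forall e : edge D, src e != tgt e].

Definition uloopless (U : ugraph) : bool :=
  [forall e : uedge U, #|uends e| == 2].

Record loopless_digraph := LooplessDigraph {
  lgraph :> digraph;
  lgraphP : loopless lgraph }.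

Record loopless_ugraph := LooplessUGraph {
  ulgraph :> ugraph;
  ulgraphP : uloopless ulgraph }.

(* A homomorphism is a vertex map sending adjacent vertices to adjacent
   vertices; it does not carry a choice among parallel edges. *)
Definition is_dhom (G H : digraph) (f : {ffun vert G -> vert H}) : bool :=
  [forall e : edge G, exists e' : edge H,
     (src e' == f (src e)) && (tgt e' == f (tgt e))].

Record dhom (G H : digraph) := DHom {
  dhom_fun :> {ffun vert G -> vert H};
  dhomP : is_dhom dhom_fun }.

Definition is_uhom (G H : ugraph) (f : {ffun uvert G -> uvert H}) : bool :=
  [forall e : uedge G, exists e' : uedge H, uends e' == [set f x | x in uends e]].

Record uhom (G H : ugraph) := UHom {
  uhom_fun :> {ffun uvert G -> uvert H};
  uhomP : is_uhom uhom_fun }.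

Lemma is_dhom_id (G : digraph) : is_dhom [ffun x : vert G => x].
Proof. by apply/forallP => e; apply/existsP; exists e; rewrite !ffunE !eqxx. Qed.

Lemma is_dhom_comp (G H K : digraph) (g : dhom H K) (f : dhom G H) :
  is_dhom [ffun x => g (f x)].
Proof.
apply/forallP => e; apply/existsP.
have /existsP[e1 /andP[/eqP s1 /eqP t1]] := forallP (dhomP f) e.
have /existsP[e2 /andP[/eqP s2 /eqP t2]] := forallP (dhomP g) e1.
by exists e2; rewrite !ffunE s2 t2 s1 t1 !eqxx.
Qed.

Definition dhom_id (G : digraph) : dhom G G := DHom (is_dhom_id G).
Definition dhom_comp (G H K : digraph) (g : dhom H K) (f : dhom G H) : dhom G K :=
  DHom (is_dhom_comp g f).

Lemma is_uhom_id (G : ugraph) : is_uhom [ffun x : uvert G => x].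
Proof.
apply/forallP => e; apply/existsP; exists e; apply/eqP.
by rewrite (eq_imset (g := id)) ?imset_id // => x; rewrite ffunE.
Qed.

Lemma is_uhom_comp (G H K : ugraph) (g : uhom H K) (f : uhom G H) :
  is_uhom [ffun x => g (f x)].
Proof.
apply/forallP => e; apply/existsP.
have /existsP[e1 /eqP s1] := forallP (uhomP f) e.
have /existsP[e2 /eqP s2] := forallP (uhomP g) e1.
exists e2; rewrite s2 s1 -imset_comp; apply/eqP/eq_imset => x.
by rewrite ffunE.
Qed.

Definition uhom_id (G : ugraph) : uhom G G := UHom (is_uhom_id G).
Definition uhom_comp (G H K : ugraph) (g : uhom H K) (f : uhom G H) :
  uhom G K := UHom (is_uhom_comp g f).

Section Circuits.
Variable D : digraph.
Implicit Types (W : {set vert D}) (C : {set edge D}).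

(* A loop contributes two edge-ends to its vertex. *)
Definition degree_in C (v : vert D) : nat :=
  (#|[set e in C | src e == v]| + #|[set e in C | tgt e == v]|)%N.

Definition adjacent_in C (u v : vert D) : bool :=
  [exists e in C, ((src e == u) && (tgt e == v))
               || ((src e == v) && (tgt e == u))].

Definition is_circuit W C : bool :=
  [&& [forall e in C, (src e \in W) && (tgt e \in W)],
      W != set0,
      [forall u in W, forall v in W, connect (adjacent_in C) u v] &
      [forall v in W, degree_in C v == 2]].

(* The pair (e, b) is the edge e traversed forwards if b = true and backwards
   if b = false. *)
Definition step_start (d : edge D * bool) := if d.2 then src d.1 else tgt d.1.
Definition step_end (d : edge D * bool) := if d.2 then tgt d.1 else src d.1.

(* A closed walk that uses every edge of C exactly once; when C is a circuit
   it goes around C, in one of the two directions. *)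
Definition is_traversal C (s : seq (edge D * bool)) : bool :=
  cycle (fun d d' => step_end d == step_start d') s
  && perm_eq [seq d.1 | d <- s] (enum C).

Definition tension (M : zmodType) (tau : edge D -> M) : Prop :=
  forall W C s, is_circuit W C -> is_traversal C s ->
    \sum_(e in C | (e, true) \in s) tau e
    = \sum_(e in C | (e, false) \in s) tau e.

End Circuits.

Definition tension_continuous (M : zmodType) (D D' : digraph)
    (f : {ffun edge D -> edge D'}) : Prop :=
  forall tau : edge D' -> M, tension tau -> tension (tau \o f).

Definition is_orientation (U : ugraph) (s t : uedge U -> uvert U) : Prop :=
  forall e, uends e = [set s e; t e].

Definition utension_continuous (M : zmodType) (U U' : ugraph)
    (f : {ffun uedge U -> uedge U'}) : Prop :=
  exists s t : uedge U -> uvert U, exists s' t' : uedge U' -> uvert U',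
    [/\ is_orientation s t, is_orientation s' t' &
        @tension_continuous M (DiGraph s t) (DiGraph s' t') f].

(* Main.v *)
(* An arc (u, v) is replaced by a path u - s - t - v; the inner vertices
   and the vertices u are joined to a rigid graph of constants according to
   their type, and one constant, the apex, is joined to all other vertices.
   Testing a tension-continuous map on the tensions of single-vertex cuts shows
   that, over any nonzero ring and for any orientations, it sends a triangle
   to a triangle or to a single edge, and that the latter cannot happen inside a
   K_4. Hence the images of the apex edges define a homomorphism from the graph
   of constants to the graph whose vertices are the edges between types, two of
   them being adjacent if they lie in a common triangle. A finite search shows
   that the only such homomorphism sends the constant c to the edge (apex, c).
   The map therefore preserves apex edges and types, every other edge is
   determined by its triangle with the apex, and the incidences along the
   paths make the induced map on the vertices u a homomorphism. *)
Require Import Defs.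
From mathcomp Require Import all_boot ssralg.

Set Implicit Arguments.
Unset Strict Implicit.
Unset Printing Implicit Defensive.

Lemma eq_set2 (T : finType) (a b u v : T) : u != v ->
  [set a; b] = [set u; v] -> (a = u /\ b = v) \/ (a = v /\ b = u).
Proof.
move=> uv E; have := set21 u v; have := set22 u v.
have := set21 a b; have := set22 a b; rewrite {1 2}E -E !inE.
by do 4![case/orP => /eqP ?]; subst; auto; rewrite ?eqxx in uv.
Qed.

(** * Tensions, potentials and triangles *)

Section Tensions.
Import GRing.Theory.
Local Open Scope ring_scope.

Variables (D : digraph) (M : zmodType).
Implicit Types (C : {set edge D}) (s : seq (edge D * bool)) (tau : edge D -> M).

(** A traversal uses each edge of [C] once, hence in one direction only, so the two sums are the two
    halves of the signed sum along the walk. *)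
Lemma traversal_sum C s tau : is_traversal C s ->
  \sum_(e in C | (e, true) \in s) tau e - \sum_(e in C | (e, false) \in s) tau e
  = \sum_(d <- s) (if d.2 then tau d.1 else - tau d.1).
Proof.
case/andP => _ Cs; have us : uniq [seq d.1 | d <- s].
  by rewrite (perm_uniq Cs) enum_uniq.
have dirE b : \sum_(e in C | (e, b) \in s) tau e = \sum_(d <- s | d.2 == b) tau d.1.
  rewrite -big_enum_cond /= -(perm_big _ Cs) big_map big_seq_cond [RHS]big_seq_cond.
  apply: eq_bigl => -[e c] /=; case: (boolP ((e, c) \in s)) => //= ecs.
  apply/idP/eqP => [|<- //]; elim: (s) us ecs => //= -[e1 c1] s1 IH /andP[e1s1 us1].
  have notin b' : (e1, b') \in s1 = false.
    by apply: contraNF e1s1 => e1b'; apply/mapP; exists (e1, b').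
  rewrite !inE !xpair_eqE; case: eqP => [-> | _] /=; last exact: IH.
  by rewrite !notin !orbF => /eqP -> /eqP.
rewrite !dirE [RHS](bigID (fun d => d.2)) /= -sumrN; congr (_ + _).
  by apply: eq_big => [[e []]|[e []]].
by apply: eq_big => [[e []]|[e []]].
Qed.

(** Along a closed walk the differences of the potential telescope to zero. *)
Lemma tension_of_potential (p : vert D -> M) tau :
  (forall e, tau e = p (tgt e) - p (src e)) -> tension tau.
Proof.
move=> tauE W C s _ Cs; apply/eqP; rewrite -subr_eq0 traversal_sum //.
case/andP: Cs => cs _; apply/eqP.
rewrite (eq_bigr (fun d => p (step_end d) - p (step_start d))); last first.
  by move=> [e []] _ /=; rewrite tauE ?opprB.
case: s cs => [_|d s]; first by rewrite big_nil.
(* Moving the first step to the end turns the cyclic condition into a path from [d] back to [d]. *)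
move=> /= dP; rewrite (perm_big (rcons s d)) /= 1?perm_sym ?perm_rcons //.
suff telescope q d0 : path (fun d d' => step_end d == step_start d') d0 q ->
    \sum_(d <- q) (p (step_end d) - p (step_start d))
    = p (step_end (last d0 q)) - p (step_end d0).
  by rewrite (telescope _ _ dP) last_rcons subrr.
elim: q d0 => [|d1 q IH] d0 /=; first by rewrite big_nil subrr.
by case/andP => /eqP -> /IH; rewrite big_cons => ->; rewrite addrC subrKA.
Qed.

(** The value of [tau] on [e] walked away from its end [u], which removes the orientation of [e]
    from statements about triangles. *)
Definition along tau (e : edge D) (u : vert D) : M :=
  if src e == u then tau e else - tau e.

Lemma tension_triangle tau x y z exy eyz ezx :
  x != y -> y != z -> z != x ->
  [set src exy; tgt exy] = [set x; y] ->
  [set src eyz; tgt eyz] = [set y; z] ->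
  [set src ezx; tgt ezx] = [set z; x] ->
  tension tau -> along tau exy x + along tau eyz y + along tau ezx z = 0.
Proof.
move=> xy yz zx Exy Eyz Ezx tauT.
have startE (e : edge D) u v : u != v -> [set src e; tgt e] = [set u; v] ->
    (step_start (e, src e == u) = u) * (step_end (e, src e == u) = v).
  rewrite /step_start /step_end /= => uv /(eq_set2 uv)[] [-> ->]; rewrite ?eqxx //.
  by rewrite eq_sym (negbTE uv).
have degE (e : edge D) u v : u != v -> [set src e; tgt e] = [set u; v] ->
    forall w, ((src e == w) + (tgt e == w) = (u == w) + (v == w))%N.
  by move=> uv /(eq_set2 uv)[] [-> ->] w //; rewrite addnC.
pose C := [set exy; eyz; ezx].
pose s := [:: (exy, src exy == x); (eyz, src eyz == y); (ezx, src ezx == z)].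
have nxy : exy != eyz.
  apply/eqP => e; have := set21 x y; rewrite -Exy e Eyz !inE.
  by rewrite (negbTE xy) eq_sym (negbTE zx).
have nyz : eyz != ezx.
  apply/eqP => e; have := set21 y z; rewrite -Eyz e Ezx !inE.
  by rewrite (negbTE yz) eq_sym (negbTE xy).
have nxz : exy != ezx.
  apply/eqP => e; have := set22 x y; rewrite -Exy e Ezx !inE.
  by rewrite (negbTE yz) eq_sym (negbTE xy).
have usC : uniq [:: exy; eyz; ezx] by rewrite /= !inE nyz (negbTE nxy) nxz.
have trav : is_traversal C s.
  apply/andP; split.
    rewrite /= !(startE _ _ _ xy Exy) !(startE _ _ _ yz Eyz) !(startE _ _ _ zx Ezx).
    by rewrite !eqxx.
  by apply: uniq_perm => // [|e]; rewrite ?enum_uniq // mem_enum !inE orbA.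
have sumC (I : nmodType) (F : edge D -> I) :
    \sum_(e in C) F e = F exy + F eyz + F ezx.
  rewrite -big_enum (perm_big [:: exy; eyz; ezx]) /=; last first.
    by apply: uniq_perm => // [|e]; rewrite ?enum_uniq // mem_enum !inE orbA.
  by rewrite !big_cons big_nil addr0 addrA.
have circ : is_circuit [set x; y; z] C.
  apply/and4P; split.
  - apply/forall_inP => e; have := set21 (src e) (tgt e); have := set22 (src e) (tgt e).
    by rewrite /C !inE => se te /orP[/orP[]|] /eqP eE; move: se te;
      rewrite eE -!in_set2 ?Exy ?Eyz ?Ezx !inE => /orP[]/eqP -> /orP[]/eqP ->;
      rewrite !eqxx ?orbT.
  - by apply/set0Pn; exists x; rewrite !inE eqxx.
  - have adjE e u v : e \in C -> u != v -> [set src e; tgt e] = [set u; v] ->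
        connect (adjacent_in C) u v /\ connect (adjacent_in C) v u.
      move=> eC uv /(eq_set2 uv) eE; split; apply/connect1/exists_inP; exists e => //;
        by case: eE => -[-> ->]; rewrite !eqxx ?orbT.
    have [] := adjE exy x y; rewrite ?inE ?eqxx //.
    have [] := adjE eyz y z; rewrite ?inE ?eqxx ?orbT //.
    have [] := adjE ezx z x; rewrite ?inE ?eqxx ?orbT // => *.
    by apply/forall_inP => u uW; apply/forall_inP => v; move: uW; rewrite !inE;
      do 2![case/orP => [/orP[]|] /eqP ->].
  - apply/forall_inP => v vW; rewrite /degree_in.
    (* Counting edge-ends edge by edge makes the degree depend only on the three end sets. *)
    have -> : (#|[set e in C | src e == v]| + #|[set e in C | tgt e == v]| =
               \sum_(e in C) ((src e == v) + (tgt e == v)))%N.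
      rewrite big_split /= -!sum1dep_card !big_mkcondr /=.
      by congr addn; apply: eq_bigr => e _; case: eqP.
    rewrite (sumC nat) !(degE _ _ _ xy Exy) !(degE _ _ _ yz Eyz) !(degE _ _ _ zx Ezx).
    move: vW; rewrite !inE => /orP[/orP[]|] /eqP ->; rewrite !eqxx.
    + by rewrite (negbTE zx) (eq_sym y) (negbTE xy).
    + by rewrite (negbTE xy) (eq_sym z) (negbTE yz).
    + by rewrite (negbTE yz) (eq_sym x) (negbTE zx).
have := tauT _ _ _ circ trav => /eqP; rewrite -subr_eq0 traversal_sum // => /eqP.
by rewrite !big_cons big_nil addr0 addrA.
Qed.

End Tensions.

(** * Images of triangles and of K_4 under tension-continuous maps *)

Lemma card2_eq_set2 (T : finType) (A : {set T}) x y :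
  #|A| = 2 -> x \in A -> y \in A -> x != y -> A = [set x; y].
Proof.
move=> A2 xA yA xy; apply/esym/eqP; rewrite eqEcard cards2 xy A2 leqnn andbT.
by apply/subsetP => z; rewrite !inE => /orP[]/eqP ->.
Qed.

(** A point of [A] outside [B] and a point of [B] outside [A] both lie in [C] and exhaust it; the
    other point of [A] can then be covered only by [B]. *)
Lemma triangle_of_cover (T : finType) (A B C : {set T}) :
    #|A| = 2 -> #|B| = 2 -> #|C| = 2 -> A != B ->
    A \subset B :|: C -> B \subset A :|: C -> C \subset A :|: B ->
  exists p q r, [/\ uniq [:: p; q; r], A = [set p; q], B = [set p; r] & C = [set q; r]].
Proof.
move=> A2 B2 C2 nAB /subsetP Acov /subsetP Bcov /subsetP Ccov.
have /subsetPn[q qA qB] : ~~ (A \subset B).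
  by apply: contra nAB => AB; rewrite eqEcard AB A2 B2.
have /subsetPn[r rB rA] : ~~ (B \subset A).
  by apply: contra nAB => BA; rewrite eq_sym eqEcard BA A2 B2.
have qr : q != r by apply: contraNneq qB => ->.
have CE : C = [set q; r].
  apply: card2_eq_set2 => //.
    by have := Acov _ qA; rewrite inE (negbTE qB).
  by have := Bcov _ rB; rewrite inE (negbTE rA).
have /card_gt0P[p] : 0 < #|A :\ q| by move: A2; rewrite (cardsD1 q) qA add1n => -[->].
rewrite !inE => /andP[pq pA].
have pr : p != r by apply: contraNneq rA => <-.
have pB : p \in B.
  by have := Acov _ pA; rewrite CE !inE (negbTE pq) (negbTE pr) !orbF.
exists p, q, r; split=> //; first by rewrite /= !inE (negbTE pq) (negbTE pr) qr.
  exact: card2_eq_set2.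
exact: card2_eq_set2.
Qed.

Definition ends (D : digraph) (e : edge D) : {set vert D} := [set src e; tgt e].

Section TensionContinuous.
Import GRing.Theory.
Local Open Scope ring_scope.

Variables (M : nzRingType) (D D' : digraph) (phi : {ffun edge D -> edge D'}).
Hypotheses (phiT : tension_continuous M phi) (D'loopless : loopless D').

Let nst (e : edge D') : src e != tgt e. Proof. exact: forallP D'loopless e. Qed.
Let ends2 (e : edge D') : #|ends e| = 2. Proof. by rewrite cards2 nst. Qed.

Let ind (w x : vert D') : M := (x == w)%:R.
(** The pullback along [phi] of the tension of the cut at the single vertex [w], whose potential is
    the indicator of [w]. *)
Let cut w (e : edge D) : M := ind w (tgt (phi e)) - ind w (src (phi e)).

Let cut_tension w : tension (cut w).
Proof.
apply: (phiT (tau := fun e => ind w (tgt e) - ind w (src e))).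
exact: (tension_of_potential (p := ind w)).
Qed.

Let along_cut0 w e u : w \notin ends (phi e) -> along (cut w) e u = 0.
Proof.
rewrite !inE negb_or /along /cut /ind => /andP[/negbTE ws /negbTE wt].
by rewrite ![_ == w]eq_sym ws wt subrr oppr0 if_same.
Qed.

Let along_cut_pm1 w e u : w \in ends (phi e) ->
  {b : bool | along (cut w) e u = (-1) ^+ b}.
Proof.
rewrite !inE /along /cut /ind => we.
exists ((w == src (phi e)) (+) (src e != u)).
case: (eqVneq w (src (phi e))) we (nst (phi e)) => [-> _ | ws /= /eqP -> _].
  rewrite eq_sym => /negbTE ->; rewrite ?eqxx sub0r.
  by case: ifP; rewrite /= ?expr0 ?expr1 ?opprK.
rewrite eqxx eq_sym; case: eqP ws => // /eqP ? _; rewrite subr0.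
by case: ifP; rewrite /= ?expr0 ?expr1 ?opprK.
Qed.

Let sign_neq0 (b : bool) : (-1) ^+ b != 0 :> M.
Proof. by rewrite signr_eq0. Qed.

(** If [w] were an end of the first image only, the sum of [cut w] around the triangle would be a
    single sign, which is nonzero in [M]. *)
Lemma triangle_cover x y z exy eyz ezx : uniq [:: x; y; z] ->
  ends exy = [set x; y] -> ends eyz = [set y; z] -> ends ezx = [set z; x] ->
  ends (phi exy) \subset ends (phi eyz) :|: ends (phi ezx).
Proof.
rewrite /= !inE negb_or => /and3P[/andP[xy xz] yz _] Exy Eyz Ezx.
have zx : z != x by rewrite eq_sym.
apply/subsetP => w we; rewrite inE; apply/norP => -[wn1 wn2].
have := tension_triangle xy yz zx Exy Eyz Ezx (cut_tension w).
rewrite (along_cut0 _ wn1) (along_cut0 _ wn2) !addr0.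
by have [b ->] := along_cut_pm1 x we; apply/eqP.
Qed.

Lemma ends_triangle x y z exy eyz ezx : uniq [:: x; y; z] ->
    ends exy = [set x; y] -> ends eyz = [set y; z] -> ends ezx = [set z; x] ->
    ends (phi exy) != ends (phi eyz) ->
  exists p q r, [/\ uniq [:: p; q; r], ends (phi exy) = [set p; q],
    ends (phi eyz) = [set p; r] & ends (phi ezx) = [set q; r]].
Proof.
move=> u Exy Eyz Ezx ne; apply: triangle_of_cover => //.
- exact: triangle_cover u Exy Eyz Ezx.
- rewrite setUC; apply: (triangle_cover (x := y) (y := z) (z := x)) => //.
  by rewrite -(rot_uniq 2).
- by apply: (triangle_cover (x := z) (y := x) (z := y)) => //; rewrite -(rot_uniq 1).
Qed.

(* Over a ring of characteristic 3 a triangle may be mapped onto a single edge,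
   but then it must be cyclically oriented with respect to that edge, and K_4
   has no orientation all of whose triangles are cyclic. *)
Lemma K4_noncollapse a x y z (eax eay eaz exy eyz ezx : edge D) :
    uniq [:: a; x; y; z] ->
    ends eax = [set a; x] -> ends eay = [set a; y] -> ends eaz = [set a; z] ->
    ends exy = [set x; y] -> ends eyz = [set y; z] -> ends ezx = [set z; x] ->
  ends (phi eax) != ends (phi eay).
Proof.
rewrite /= !inE !negb_or -!andbA => /and5P[ax ay az xy /and3P[xz yz _]] Eax Eay Eaz Exy Eyz Ezx.
have Exa : ends eax = [set x; a] by rewrite setUC.
have Eya : ends eay = [set y; a] by rewrite setUC.
have Eza : ends eaz = [set z; a] by rewrite setUC.
have Eyx : ends exy = [set y; x] by rewrite setUC.
have Ezy : ends eyz = [set z; y] by rewrite setUC.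
have Exz : ends ezx = [set x; z] by rewrite setUC.
have u3 (u v w : vert D) : u != v -> u != w -> v != w -> uniq [:: u; v; w].
  by move=> uv uw vw; rewrite /= !inE negb_or uv uw vw.
have [xa ya za zx] : [/\ x != a, y != a, z != a & z != x].
  by split; rewrite eq_sym.
apply/eqP => Pay; set P := ends (phi eax) in Pay.
have squeeze e : ends (phi e) \subset P -> ends (phi e) = P.
  by move=> eP; apply/eqP; rewrite eqEcard eP !ends2.
have Pxy : ends (phi exy) = P.
  apply: squeeze; have := triangle_cover (u3 _ _ _ xy xa ya) Exy Eya Eax.
  by rewrite -Pay setUid.
(* If the third edge at [a] has other image ends, the triangles [x a z] and [y a z] are mapped to
   triangles. The common end [p] of [P] and that image is then missed by the images of [ezx] and
   [eyz], but it is an end of the image of [exy], against [triangle_cover]. *)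
have [Paz | nPaz] := eqVneq P (ends (phi eaz)); last first.
  have [p [q [r [u1 P1 Z1 zx1]]]] := ends_triangle (u3 _ _ _ xa xz az) Exa Eaz Ezx nPaz.
  rewrite -/P in P1; rewrite Pay in nPaz.
  have [p' [q' [r' [u2 P2 Z2 zy2]]]] := ends_triangle (u3 _ _ _ ya yz az) Eya Eaz Ezy nPaz.
  have pp' : p' = p.
    have := set21 p' q'; rewrite -P2 -Pay P1 !inE => /orP[/eqP // | /eqP p'q].
    have := set21 p' r'; rewrite -Z2 Z1 !inE => /orP[/eqP // | /eqP p'r].
    by move: u1; rewrite -p'q -p'r /= !inE eqxx andbF.
  have /subsetP/(_ p) := triangle_cover (u3 _ _ _ xy xz yz) Exy Eyz Ezx.
  rewrite Pxy P1 zx1 zy2 set21 !inE => /(_ isT); move: u1 u2; rewrite pp' /= !inE.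
  by do 2![case/and3P => /norP[/negbTE -> /negbTE ->] _ _].
have Pyz : ends (phi eyz) = P.
  apply: squeeze; have := triangle_cover (u3 _ _ _ yz ya za) Eyz Eza Eay.
  by rewrite -Pay -Paz setUid.
have Pzx : ends (phi ezx) = P.
  apply: squeeze; have := triangle_cover (u3 _ _ _ zx za xa) Ezx Exa Eaz.
  by rewrite -Paz setUid.
(* Now all six edges are mapped onto [P], so [cut w] is a sign on each of them. *)
have wP : src (phi eax) \in P by rewrite set21.
set w := src (phi eax) in wP; pose s e u := along (cut w) e u.
have sE e u : ends (phi e) = P -> {b : bool | s e u = (-1) ^+ b}.
  by move=> eP; apply: along_cut_pm1; rewrite eP.
have rev e u v : u != v -> ends e = [set u; v] -> s e v = - s e u.
  rewrite /s /along => uv /(eq_set2 uv)[] [-> _]; rewrite eqxx.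
    by rewrite (negbTE uv).
  by rewrite eq_sym (negbTE uv) opprK.
(* Equal signs at [a] would cancel around the triangle [a u v] and leave the sign of [euv] alone. *)
have neq u v eau euv eav : a != u -> u != v -> v != a ->
    ends eau = [set a; u] -> ends euv = [set u; v] -> ends eav = [set a; v] ->
    ends (phi euv) = P -> s eau a != s eav a.
  move=> au uv va Eau Euv Eav Puv; apply/eqP => sE2.
  have Eva : ends eav = [set v; a] by rewrite setUC.
  have := tension_triangle au uv va Eau Euv Eva (cut_tension w).
  rewrite -!/(s _ _) (rev eav a v) // 1?eq_sym // sE2 addrAC subrr add0r => /eqP.
  by have [b ->] := sE euv u Puv; rewrite (negbTE (sign_neq0 b)).
have := neq _ _ _ _ _ ax xy ya Eax Exy Eay Pxy.
have := neq _ _ _ _ _ ay yz za Eay Eyz Eaz Pyz.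
have := neq _ _ _ _ _ az zx xa Eaz Ezx Eax Pzx.
have [b1 ->] := sE eax a erefl; have [b2 ->] := sE eay a (esym Pay).
have [b3 ->] := sE eaz a (esym Paz).
(* Three edges at [a] cannot have pairwise different signs. *)
by case: b1 b2 b3 => [] [] []; rewrite ?eqxx.
Qed.

(** The fourth vertex excludes the collapse of [a x y], so [ends_triangle] applies. *)
Lemma K4_triangle a x y z (eax eay eaz exy eyz ezx : edge D) :
    uniq [:: a; x; y; z] ->
    ends eax = [set a; x] -> ends eay = [set a; y] -> ends eaz = [set a; z] ->
    ends exy = [set x; y] -> ends eyz = [set y; z] -> ends ezx = [set z; x] ->
  exists p q r, [/\ uniq [:: p; q; r], ends (phi eax) = [set p; q],
    ends (phi eay) = [set p; r] & ends (phi exy) = [set q; r]].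
Proof.
move=> u Eax Eay Eaz Exy Eyz Ezx.
have ne := K4_noncollapse u Eax Eay Eaz Exy Eyz Ezx.
apply: (ends_triangle (x := x) (y := a) (z := y)) => //; try by rewrite setUC.
move: u; rewrite /= !inE !negb_or -!andbA => /and5P[ax ay _ xy _].
by rewrite (eq_sym x) ax xy ay.
Qed.

End TensionContinuous.

(** * The type graph and its rigidity *)

(* The type graph, found by a computer search: [lower j] lists the neighbours of
   [j] that precede it. Type 0 is the apex, 1 to 9 are the other constants, 10 is
   the type of the vertices [u] of the encoded graph, 11 and 12 are the types of
   the two inner vertices of a path that encodes an arc. *)
Definition lower (j : nat) : seq nat := nth [::]
  [:: [::]; [:: 0]; [:: 0; 1]; [:: 0; 1; 2]; [:: 0; 1; 2; 3]; [:: 0; 1; 3; 4];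
      [:: 0; 1; 2; 4]; [:: 0; 1; 5; 6]; [:: 0; 2; 5; 6; 7]; [:: 0; 2; 3; 5; 7; 8];
      [:: 0; 2; 3; 9]; [:: 0; 1; 6; 7; 10]; [:: 0; 2; 3; 6; 8; 10; 11]] j.

Definition tyadj (i j : nat) : bool := (i \in lower j) || (j \in lower i).

Definition tyedges : seq (nat * nat) :=
  [seq (i, j) | j <- iota 0 13, i <- lower j].

(** Adjacency in the graph whose vertices are the type edges: being two sides of one triangle. *)
Definition cotriangle (e f : nat * nat) : bool :=
  [|| (e.1 == f.1) && tyadj e.2 f.2, (e.1 == f.2) && tyadj e.2 f.1,
      (e.2 == f.1) && tyadj e.1 f.2 | (e.2 == f.2) && tyadj e.1 f.1].

(* Precomputed, so that the search below only handles indices in [tyedges]. *)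
Definition cotriangle_rows : seq (seq bool) :=
  Eval vm_compute in [seq [seq cotriangle e f | f <- tyedges] | e <- tyedges].

(** One step of the search. Values are indices in [tyedges], which has 49 entries; [l] lists the
    earlier constants whose images must be adjacent to the new one. *)
Definition extensions (s l : seq nat) : seq nat :=
  mask (foldr (fun i m => [seq p.1 && p.2 | p <- zip (nth [::] cotriangle_rows (nth 0 s i)) m])
          (nseq 49 true) l) (iota 0 49).

(** The homomorphisms defined on the constants 1 to [k]. The leading 0 fills the place of the apex
    and is never read, as [behead] drops the apex from [lower]. *)
Fixpoint partial_maps (k : nat) : seq (seq nat) :=
  if k is k'.+1 then
    flatten [seq [seq rcons s e | e <- extensions s (behead (lower k))] | s <- partial_maps k']
  else [:: [:: 0]].

Lemma partial_mapsS k : partial_maps k.+1 =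
  flatten [seq [seq rcons s e | e <- extensions s (behead (lower k.+1))] | s <- partial_maps k].
Proof. by []. Qed.

Lemma partial_maps9 :
  partial_maps 9 = [:: 0 :: mkseq (fun i => index (0, i.+1) tyedges) 9].
Proof. by vm_compute. Qed.

Lemma cotriangle_rowsE e f : e \in tyedges -> f \in tyedges ->
  nth false (nth [::] cotriangle_rows (index e tyedges)) (index f tyedges) = cotriangle e f.
Proof.
have -> : cotriangle_rows = [seq [seq cotriangle e f | f <- tyedges] | e <- tyedges].
  by vm_compute.
move: tyedges => s es fs.
by rewrite (nth_map e) ?index_mem // (nth_map f) ?index_mem // !nth_index.
Qed.

Lemma mem_extensions s l e : e < 49 ->
  {in l, forall i, nth false (nth [::] cotriangle_rows (nth 0 s i)) e} ->
  e \in extensions s l.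
Proof.
move=> e49 le; rewrite /extensions in_mask ?iota_uniq // mem_iota leq0n add0n e49 !andTb.
have -> : index e (iota 0 49) = e.
  by rewrite -{1}[e](nth_iota 0 0 e49) index_uniq ?iota_uniq // size_iota.
elim: l le => [|i l IH] le; first by rewrite nth_nseq e49.
have := IH (fun j jl => le j (mem_behead (s := i :: l) jl)); have := le i (mem_head i l).
rewrite [foldr _ _ (i :: l)]/=; move: (nth [::] _ _) (foldr _ _ _) => r m.
by elim: r m (e) => [|a r IHr] [|b m] [|n] //=; [move=> -> | apply: IHr].
Qed.

Lemma behead_lower k i : k < 10 -> i \in behead (lower k) -> 0 < i < k.
Proof.
move=> k10; have /allP/(_ k) :
    all (fun k => all (fun i => 0 < i < k) (behead (lower k))) (iota 0 10) by [].
by rewrite mem_iota => /(_ k10)/allP; apply.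
Qed.

(** The indices of [h 1] to [h k] form a branch of the search, and only one branch reaches 9. *)
Lemma constants_rigid (h : nat -> nat * nat) :
    (forall k, 0 < k < 10 -> h k \in tyedges) ->
    (forall k i, 0 < k < 10 -> i \in behead (lower k) -> cotriangle (h i) (h k)) ->
  forall k, 0 < k < 10 -> h k = (0, k).
Proof.
move=> hE hT; pose t k := 0 :: mkseq (fun i => index (h i.+1) tyedges) k.
have tP k : k < 10 -> t k \in partial_maps k.
  elim: k => [_|k IH k10]; [exact: mem_head | rewrite partial_mapsS].
  apply/flattenP; exists [seq rcons (t k) e | e <- extensions (t k) (behead (lower k.+1))].
    by apply: map_f; apply: IH; apply: ltnW.
  rewrite {1}/t mkseqS -rcons_cons -/(t k).
  apply: map_f; apply: mem_extensions; first by rewrite -[49]/(size tyedges) index_mem hE.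
  move=> i ik; have /andP[i0 ilt] := behead_lower k10 ik.
  (* Because of the dummy in front, position [i] of [t k] holds the index of [h i]. *)
  rewrite /t -(prednK i0) /= nth_mkseq; last by rewrite -ltnS prednK.
  rewrite prednK // cotriangle_rowsE ?hT ?hE //.
  by rewrite i0 (ltn_trans ilt).
move=> k k09; have kE : (0, k) \in tyedges.
  by case: k k09 => // k; do 9![case: k => [|k] //].
have k9 : k.-1 < 9 by case: k k09 {kE}.
have kK : k.-1.+1 = k by case: k k09 {kE k9}.
have mkseq_inj (f g : nat -> nat) n : 0 :: mkseq f n = 0 :: mkseq g n -> {in gtn n, f =1 g}.
  case=> fg i; rewrite inE => ni.
  by rewrite -(nth_mkseq 0 f ni) fg nth_mkseq.
have index_inj (s : seq (nat * nat)) : h k \in s -> (0, k) \in s ->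
    index (h k.-1.+1) s = index (0, k.-1.+1) s -> h k = (0, k).
  by rewrite kK => hs ks hk; rewrite -(nth_index (0, 0) hs) hk nth_index.
apply: (index_inj _ (hE _ k09) kE).
have := tP 9 isT; rewrite partial_maps9 mem_seq1 => /eqP tE.
exact: (mkseq_inj (fun i => index (h i.+1) tyedges) _ _ tE _ k9).
Qed.

Lemma lower_lt13 i j : i \in lower j -> i < j < 13.
Proof.
move=> ij; have [j13 | j13] := ltnP j 13; last by move: ij; rewrite /lower nth_default.
have /allP/(_ j) : all (fun j => all (fun i => i < j < 13) (lower j)) (iota 0 13) by [].
by rewrite mem_iota => /(_ j13)/allP/(_ i ij)/andP[->].
Qed.

Lemma mem0_lower j : 0 < j < 13 -> 0 \in lower j.
Proof. by case: j => // j; do 12![case: j => [|j] //]. Qed.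

Lemma tyadj_neq i j : tyadj i j -> i != j.
Proof. by case/orP => /lower_lt13/andP[]; rewrite ltn_neqAle => /andP[]; rewrite 1?eq_sym. Qed.

Lemma mem_tyedges e : (e \in tyedges) = (e.1 \in lower e.2).
Proof.
case: e => i j; apply/allpairsPdep/idP => [[j' [i' [_ ij [-> ->]]]] // | ij].
exists j, i; split=> //; rewrite mem_iota.
by have /andP[] := lower_lt13 ij.
Qed.

(** Together with the apex, [z] completes the edge to a K_4, as [K4_triangle] requires. *)
Lemma constant_common_neighbour i j : 0 < i < 10 -> i \in lower j ->
  exists z, [/\ 0 < z < 10, tyadj z i & tyadj z j].
Proof.
move=> i10 ij; have j13 : j < 13 by case/andP: (lower_lt13 ij).
have /allP/(_ j) : all (fun j => all (fun i => (0 < i < 10) ==>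
    has (fun z => tyadj z i && tyadj z j) (iota 1 9)) (lower j)) (iota 0 13) by vm_compute.
rewrite mem_iota => /(_ j13)/allP/(_ i ij); rewrite i10 => /hasP[z].
by rewrite mem_iota => z10 /andP[]; exists z.
Qed.

(** Carries rigidity from the constants to the types 10, 11 and 12, by inspection of all type
    edges. *)
Lemma common_cotriangle e x : e \in tyedges -> 10 <= x < 13 ->
  (forall i, i \in lower x -> 0 < i < 10 -> cotriangle (0, i) e) -> e = (0, x).
Proof.
move=> eE x10 xe; apply/eqP.
have /allP/(_ x) : all (fun x => all (fun e => all (fun i => (0 < i < 10) ==>
    cotriangle (0, i) e) (lower x) ==> (e == (0, x))) tyedges) (iota 10 3) by vm_compute.
rewrite mem_iota => /(_ x10)/allP/(_ e eE)/implyP. apply.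
by apply/allP => i ix; apply/implyP; apply: xe.
Qed.

(** * The gadget of a relation *)

Section Gadget.
Variables (V : finType) (R : rel V).

Definition gvert : finType := ('I_10 + V + V * V * bool)%type.

Definition constant (i : nat) : gvert := inl (inl (inord i)).
Definition base (u : V) : gvert := inl (inr u).
Definition inner (u v : V) (b : bool) : gvert := inr (u, v, b).

Definition ty (x : gvert) : nat :=
  match x with inl (inl i) => i | inl (inr _) => 10 | inr (_, b) => 11 + b end.

(* The path encoding the arc (u, v) is [base u], [inner u v false],
   [inner u v true], [base v]. *)
Definition compatible (x y : gvert) : bool :=
  match x, y with
  | inl (inr w), inr (u, v, b) => w == if b then v else u
  | inr (p, _), inr (p', _) => p == p'
  | _, _ => true
  end.

(* Pairs that are not arcs leave isolated vertices. *)
Definition actual (x : gvert) : bool := if x is inr (u, v, _) then R u v else true.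

(** Types increase from the first component to the second, so each adjacency occurs in one order
    only, the one that [compatible] examines. *)
Definition gadj (p : gvert * gvert) : bool :=
  [&& actual p.1, actual p.2, compatible p.1 p.2 & ty p.1 \in lower (ty p.2)].

Definition gedge : finType := {p | gadj p}.

Definition gadget : digraph :=
  DiGraph (fun e : gedge => (val e).1) (fun e : gedge => (val e).2).

Definition apex : gvert := constant 0.

Lemma ty_constant i : i < 10 -> ty (constant i) = i.
Proof. exact: inordK. Qed.

Lemma constantP x : ty x < 10 -> x = constant (ty x).
Proof. by case: x => [[i|u]|[p []]] //= _; rewrite /constant inord_val. Qed.

Lemma ty_lt13 x : ty x < 13.
Proof. by case: x => [[i|u]|[p []]] //=; apply: ltn_trans (ltn_ord i) _. Qed.

Lemma gadj_constant i y : i < 10 -> actual y -> i \in lower (ty y) -> gadj (constant i, y).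
Proof. by move=> i10 yok iy; rewrite /gadj /= yok inordK. Qed.

Lemma gadj_apex x : actual x -> 0 < ty x -> gadj (apex, x).
Proof. by move=> xok x0; apply: gadj_constant => //; rewrite mem0_lower // x0 ty_lt13. Qed.

Lemma gadjP (e : gedge) : gadj (val e). Proof. exact: valP. Qed.

Definition tyedge (e : gedge) : nat * nat := (ty (val e).1, ty (val e).2).

Lemma tyedgeP e : tyedge e \in tyedges.
Proof. by rewrite mem_tyedges; case/and4P: (gadjP e). Qed.

Lemma ends_val (e : gedge) x y : val e = (x, y) -> ends (e : edge gadget) = [set x; y].
Proof. by rewrite /ends /= => ->. Qed.

Lemma gadget_loopless : loopless gadget.
Proof.
apply/forallP => e; apply/eqP => /= xy; case/and4P: (gadjP e) => _ _ _.
by rewrite xy => /lower_lt13; rewrite ltnn.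
Qed.

Lemma tyedge_ends (e : edge gadget) p q : p != q -> ends e = [set p; q] ->
  tyedge e = (ty p, ty q) \/ tyedge e = (ty q, ty p).
Proof. by move=> pq /(eq_set2 pq)[] [/= ep eq]; rewrite /tyedge ep eq; auto. Qed.

Lemma tyadj_ends (e : edge gadget) p q : p != q -> ends e = [set p; q] -> tyadj (ty p) (ty q).
Proof.
move=> pq /(tyedge_ends pq) epq; have := tyedgeP e; rewrite mem_tyedges /tyadj.
by case: epq => -> /= ->; rewrite ?orbT.
Qed.

(** Adjacent vertices have adjacent types, so a triangle of the gadget lies over a triangle of
    types. *)
Lemma cotriangle_ends (e f g : edge gadget) p q r : uniq [:: p; q; r] ->
  ends e = [set p; q] -> ends f = [set p; r] -> ends g = [set q; r] ->
  cotriangle (tyedge e) (tyedge f).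
Proof.
rewrite /= !inE negb_or => /and3P[/andP[pq pr] qr _] Ee Ef Eg.
have := tyadj_ends qr Eg; rewrite /cotriangle.
by case: (tyedge_ends pq Ee) => ->; case: (tyedge_ends pr Ef) => -> /= ->;
  rewrite eqxx ?orbT.
Qed.

(* Tensions on the gadget are determined by their values on the edges at the
   apex, which serve as a potential. *)
Lemma gadget_potential (M : zmodType) (tau : edge gadget -> M) : tension tau ->
  exists p, forall e, tau e = (p (tgt e) - p (src e))%R.
Proof.
move=> tauT.
(* The default 0 is the value at the apex, since [(apex, apex)] is not an edge, and at the isolated
   vertices. *)
pose p y := if insub (apex, y) is Some e then tau e else 0%R.
have pE y (ay : gadj (apex, y)) : p y = tau (Sub (apex, y) ay) by rewrite /p insubT.
have p0 : p apex = 0%R.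
  rewrite /p insubF // /gadj; apply/negbTE; rewrite !negb_and.
  by apply/orP; right; rewrite ty_constant.
exists p => e; case: e => -[x y] xy /=; set e := exist _ _ _.
have := xy; rewrite /gadj => /and4P[/= xok yok _ lxy].
have [y0 y13] : 0 < ty y /\ ty y < 13.
  by have /andP[/(leq_ltn_trans (leq0n _)) ? ?] := lower_lt13 lxy.
have ay := gadj_apex yok y0; rewrite (pE y ay).
have [x0|x0] := posnP (ty x).
  have xE : x = apex by rewrite (constantP (x := x)) ?x0.
  rewrite xE p0 GRing.subr0; congr tau; apply: val_inj; by rewrite /= xE.
have ax := gadj_apex xok x0; rewrite (pE x ax).
pose ex : edge gadget := Sub (apex, x) ax; pose ey : edge gadget := Sub (apex, y) ay.
have nax : apex != x by apply: contraTneq x0 => <-; rewrite ty_constant.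
have nay : y != apex by apply: contraTneq y0 => ->; rewrite ty_constant.
have nxy : x != y by apply: contraTneq lxy => ->; apply/negP => /lower_lt13; rewrite ltnn.
have Ey : [set src ey; tgt ey] = [set y; apex] by rewrite setUC.
have := tension_triangle (exy := ex) (eyz := e) nax nxy nay erefl erefl Ey tauT.
rewrite /along /= !eqxx eq_sym (negbTE nay) => /eqP.
by rewrite GRing.subr_eq0 => /eqP <-; rewrite GRing.addrC GRing.addKr.
Qed.

End Gadget.

(** * Gadget maps induced by relation-preserving maps *)

Section GadgetMap.
Variables (V V' : finType) (R : rel V) (R' : rel V').

Definition gvert_map (f : V -> V') (x : gvert V) : gvert V' :=
  match x with
  | inl (inl i) => inl (inl i)
  | inl (inr u) => inl (inr (f u))
  | inr (u, v, b) => inr (f u, f v, b)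
  end.

Lemma ty_gvert_map f x : ty (gvert_map f x) = ty x.
Proof. by case: x => [[i|u]|[[u v] b]]. Qed.

Lemma gadj_map (f : V -> V') : {homo f : u v / R u v >-> R' u v} ->
  forall p, gadj R p -> gadj R' (gvert_map f p.1, gvert_map f p.2).
Proof.
move=> fR; have homR u v : R u v -> R' (f u) (f v) := fR u v.
move=> [x y] /and4P[/= xok yok xy lxy]; rewrite /gadj /= !ty_gvert_map lxy andbT.
apply/and3P; split.
- by case: x xok {xy lxy} => [[i|u]|[[u v] b]] //; exact: homR.
- by case: y yok {xy lxy} => [[i|u]|[[u v] b]] //; exact: homR.
- case: x y xy {xok yok lxy} => [[i|u]|[[u v] b]] [[j|w]|[[u' v'] b']] //= /eqP.
    by move=> ->; case: b'.
  by case=> -> ->.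
Qed.

Definition gedge_map (f : V -> V') (fR : {homo f : u v / R u v >-> R' u v})
    (e : gedge R) : gedge R' :=
  Sub (gvert_map f (val e).1, gvert_map f (val e).2) (gadj_map fR (valP e)).

(** A tension on the target has a potential, and composing it with [gvert_map f] gives a potential
    for the pullback. *)
Lemma gedge_map_tension_continuous (M : zmodType) f (fR : {homo f : u v / R u v >-> R' u v}) :
  tension_continuous M (D := gadget R) (D' := gadget R') [ffun e => gedge_map fR e].
Proof.
move=> tau /gadget_potential[p tauE].
apply: (tension_of_potential (D := gadget R) (p := p \o gvert_map f)) => e.
by rewrite /= ffunE tauE.
Qed.

End GadgetMap.

(** * Every tension-continuous map between gadgets is induced *)

Section Rigidity.
Variables (M : nzRingType) (V V' : finType) (R : rel V) (R' : rel V').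
(** The orientations are arbitrary, so that the result serves directed and undirected graphs
    alike. *)
Variables (s t : gedge R -> gvert V) (s' t' : gedge R' -> gvert V').
Variable phi : {ffun gedge R -> gedge R'}.
Hypothesis st_ends : forall e, [set s e; t e] = ends (e : edge (gadget R)).
Hypothesis st'_ends : forall e, [set s' e; t' e] = ends (e : edge (gadget R')).
Hypothesis phiT : tension_continuous M (D := DiGraph s t) (D' := DiGraph s' t') phi.

Local Notation G := (gadget R).
Local Notation G' := (gadget R').
Local Notation Phi e := (phi e : edge G').

Let oriented_loopless : loopless (DiGraph s' t').
Proof.
apply/forallP => e /=; apply/eqP => st; have := st'_ends e; rewrite st.
have /= ne := forallP (gadget_loopless R') e.
move/(congr1 (fun A : {set _} => #|A|)).
by rewrite /ends !cards2 eqxx ne.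
Qed.

Let phi_K4 a x y z (eax eay eaz exy eyz ezx : edge G) :
    uniq [:: a; x; y; z] ->
    ends eax = [set a; x] -> ends eay = [set a; y] -> ends eaz = [set a; z] ->
    ends exy = [set x; y] -> ends eyz = [set y; z] -> ends ezx = [set z; x] ->
  exists p q r, [/\ uniq [:: p; q; r], ends (Phi eax) = [set p; q],
    ends (Phi eay) = [set p; r] & ends (Phi exy) = [set q; r]].
Proof. rewrite -!st_ends -!st'_ends; exact: (K4_triangle phiT oriented_loopless). Qed.

Let phi_triangle x y z (exy eyz ezx : edge G) : uniq [:: x; y; z] ->
    ends exy = [set x; y] -> ends eyz = [set y; z] -> ends ezx = [set z; x] ->
    ends (Phi exy) != ends (Phi eyz) ->
  exists p q r, [/\ uniq [:: p; q; r], ends (Phi exy) = [set p; q],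
    ends (Phi eyz) = [set p; r] & ends (Phi ezx) = [set q; r]].
Proof. rewrite -!st_ends -!st'_ends; exact: (ends_triangle phiT oriented_loopless). Qed.

Let edge_between x y : gadj R (x, y) || gadj R (y, x) ->
  exists e : edge G, ends e = [set x; y].
Proof.
by case/orP => xy; [exists (Sub (x, y) xy) | exists (Sub (y, x) xy); rewrite setUC].
Qed.

Let constant_edge z x : 0 < z < 10 -> actual R x -> tyadj z (ty x) ->
  exists e : edge G, ends e = [set constant V z; x].
Proof.
case/andP => _ z10 xok zx; apply: edge_between.
have [zlx|xlz] := orP zx; first by rewrite gadj_constant.
have [/andP[xz _] x10] : ty x < z < 13 /\ ty x < 10.
  by have /andP[xz z13] := lower_lt13 xlz; rewrite xz z13 (ltn_trans xz).
apply/orP; right; rewrite {1}(constantP x10) gadj_constant ?ty_constant //.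
Qed.

(** A common constant neighbour [z] completes the apex, [i] and [y] to a K_4, so the images of the
    two apex edges are sides of a triangle. *)
Let apex_cotriangle i y (ex ey : gedge R) : 0 < i < 10 -> i \in lower (ty y) ->
  val ex = (apex V, constant V i) -> val ey = (apex V, y) ->
  cotriangle (tyedge (phi ex)) (tyedge (phi ey)).
Proof.
move=> i09 iy Ex Ey; have /andP[i0 i10] := i09.
have [z [z09 zi zy]] := constant_common_neighbour i09 iy.
have yok : actual R y by case/and4P: (gadjP ey) => _; rewrite Ey.
have [exy Exy] : exists e : edge G, ends e = [set constant V i; y].
  by apply: constant_edge => //; rewrite /tyadj iy.
have [ezy Ezy] := constant_edge z09 yok zy.
have [ezx Ezx] : exists e : edge G, ends e = [set constant V z; constant V i].
  by apply: constant_edge; rewrite ?ty_constant.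
have [eaz Eaz] : exists e : edge G, ends e = [set apex V; constant V z].
  have /andP[z0 z10] := z09; apply: edge_between; rewrite gadj_apex //.
  by rewrite ty_constant.
have Eyz : ends ezy = [set y; constant V z] by rewrite Ezy setUC.
have u4 : uniq [:: apex V; constant V i; y; constant V z].
  have /andP[z0 z10] := z09.
  have y0 : 0 < ty y by have /andP[/(leq_ltn_trans (leq0n _))] := lower_lt13 iy.
  (* The four vertices are distinct because their types are. *)
  apply: (map_uniq (f := @ty V)); rewrite /= !inordK // !inE.
  rewrite (ltn_eqF i0) (ltn_eqF y0) (ltn_eqF z0) /= !(eq_sym _ z).
  by rewrite (negbTE (tyadj_neq zi)) (negbTE (tyadj_neq zy)) (negbTE (tyadj_neq _)) // /tyadj iy.
have [p [q [r [upqr Ep Eq Er]]]] :=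
  phi_K4 (eax := ex) (eay := ey) u4 (congr1 (fun p => [set p.1; p.2]) Ex)
    (congr1 (fun p => [set p.1; p.2]) Ey) Eaz Exy Eyz Ezx.
exact: cotriangle_ends upqr Ep Eq Er.
Qed.

Let apex_constant_tyedge k (e : gedge R) : 0 < k < 10 ->
  val e = (apex V, constant V k) -> tyedge (phi e) = (0, k).
Proof.
(* The map to which [constants_rigid] applies; the default is not reached for the constants 1 to
   9. *)
pose h k := if insub (apex V, constant V k) is Some e then tyedge (phi e) else (0, 0).
have hE i : 0 < i < 10 ->
    exists2 e : gedge R, val e = (apex V, constant V i) & h i = tyedge (phi e).
  case/andP => i0 i10; have ai : gadj R (apex V, constant V i).
    by rewrite gadj_apex ?ty_constant.
  by exists (Sub (apex V, constant V i) ai); rewrite // /h insubT.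
move=> k09 Ee; have [e' Ee' <-] : exists2 e' : gedge R, val e' = val e & h k = tyedge (phi e).
  by have [e' Ee' ->] := hE k k09; exists e'; rewrite ?Ee' //;
    congr (tyedge (phi _)); apply: val_inj; rewrite Ee' Ee.
apply: constants_rigid k09 => {e Ee e' Ee' k} [k /hE[e _ ->] | k i k09 ik]; first exact: tyedgeP.
have [ek Ek ->] := hE k k09; have /andP[k0 k10] := k09.
have ilk : i \in lower k by apply: mem_behead.
have /andP[i0 ltik] := behead_lower k10 ik.
have i09 : 0 < i < 10 by rewrite i0 (ltn_trans ltik).
have [ei Ei ->] := hE i i09; apply: (apex_cotriangle i09 _ Ei Ek).
by rewrite ty_constant.
Qed.

Let apex_tyedge x (e : gedge R) : val e = (apex V, x) -> tyedge (phi e) = (0, ty x).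
Proof.
move=> Ee; have [x10|x10] := ltnP (ty x) 10.
  apply: apex_constant_tyedge; last by rewrite -(constantP x10).
  rewrite x10 andbT; case/and4P: (gadjP e) => _ _ _; rewrite Ee.
  by case/lower_lt13/andP => /(leq_ltn_trans (leq0n _)).
have x13 := ty_lt13 x; apply: common_cotriangle; rewrite ?tyedgeP ?x10 // => i ix i09.
have /andP[i0 i10] := i09.
have ai : gadj R (apex V, constant V i) by rewrite gadj_apex ?ty_constant.
rewrite -(apex_constant_tyedge i09 (e := Sub (apex V, constant V i) ai)) //.
exact: (apex_cotriangle i09 ix).
Qed.

Let apex_image x (e : gedge R) : val e = (apex V, x) ->
  exists2 x', val (phi e) = (apex V', x') & ty x' = ty x.
Proof.
move/apex_tyedge; rewrite /tyedge; case: (val (phi e)) => a' x' /= [a0 xx'].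
by exists x' => //; rewrite [a'](constantP (x := a')) a0.
Qed.

(** The images of [ex] and [ey] differ because their types do, so the triangle on [x], the apex and
    [y] is mapped to a triangle, whose third side joins [x'] and [y']. *)
Let phi_val x y x' y' (e ex ey : gedge R) :
    val e = (x, y) -> val ex = (apex V, x) -> val ey = (apex V, y) ->
    val (phi ex) = (apex V', x') -> val (phi ey) = (apex V', y') ->
  val (phi e) = (x', y').
Proof.
move=> Ee Ex Ey Ex' Ey'.
have tx : ty x' = ty x by have := apex_tyedge Ex; rewrite /tyedge Ex' => -[].
have tyy : ty y' = ty y by have := apex_tyedge Ey; rewrite /tyedge Ey' => -[].
have lxy : ty x \in lower (ty y) by case/and4P: (gadjP e) => _ _ _; rewrite Ee.
have lax : ty (apex V) \in lower (ty x) by case/and4P: (gadjP ex) => _ _ _; rewrite Ex.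
have lay : ty (apex V) \in lower (ty y) by case/and4P: (gadjP ey) => _ _ _; rewrite Ey.
have lneq W (u v : gvert W) : ty u \in lower (ty v) -> u != v.
  by apply: contraTneq => ->; apply/negP => /lower_lt13; rewrite ltnn.
have nxy' : x' != y' by apply: lneq; rewrite tx tyy.
have nax' : apex V' != x' by apply: lneq; rewrite tx.
have nay' : apex V' != y' by apply: lneq; rewrite tyy.
have u3 : uniq [:: x; apex V; y].
  by rewrite /= !inE negb_or eq_sym !lneq.
have Exa : ends (ex : edge G) = [set x; apex V] by rewrite (ends_val Ex) setUC.
have Eyx : ends (e : edge G) = [set y; x] by rewrite (ends_val Ee) setUC.
have ne : ends (Phi ex) != ends (Phi ey).
  rewrite (ends_val Ex') (ends_val Ey'); apply: contraNneq nxy' => E.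
  have := set22 (apex V') x'; rewrite E !inE => /orP[/eqP xa|//].
  by rewrite xa eqxx in nax'.
have [p [q [r [u' E1 E2 E3]]]] := phi_triangle u3 Exa (ends_val Ey) Eyx ne.
move: u'; rewrite /= !inE negb_or => /and3P[/andP[pq pr] qr _].
(* The two apex edges share only the apex, which is therefore [p]. *)
have E4 : [set q; r] = [set x'; y'].
  have [] := eq_set2 pq (etrans (esym (ends_val Ex')) E1).
    case=> pE qE; have [] := eq_set2 pr (etrans (esym (ends_val Ey')) E2).
      by case=> _ ->; rewrite qE.
    by case=> _ yp; rewrite -pE in yp; rewrite yp eqxx in nay'.
  case=> qE pE; have [] := eq_set2 pr (etrans (esym (ends_val Ey')) E2).
    by case=> aE yr; move: nax'; rewrite aE -pE eqxx.
  by case=> _ yp; move: nxy'; rewrite yp -pE eqxx.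
(* An edge lists its end of lower type first, so the end set determines the pair. *)
suff orient w : gadj R' w -> [set w.1; w.2] = [set x'; y'] -> w = (x', y').
  by apply: orient (gadjP (phi e)) _; rewrite -E4 -E3.
case: w => u v uv /(eq_set2 nxy')[] [/= uE vE]; first by rewrite uE vE.
move: uv; rewrite uE vE => /and4P[_ _ _] /=.
rewrite tx tyy => /lower_lt13/andP[yx _]; have /andP[xy _] := lower_lt13 lxy.
by rewrite ltnNge (ltnW xy) in yx.
Qed.

Lemma tension_continuous_gedge_map :
  exists f (fR : {homo f : u v / R u v >-> R' u v}), phi = [ffun e => gedge_map fR e].
Proof.
(* Only base vertices have type 10, so the images of their apex edges define [f]. *)
have [f fP] : exists f : V -> V', forall u (e : gedge R), val e = (apex V, base u) ->
    val (phi e) = (apex V', base (f u)).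
  apply: (fin_all_exists (P := fun u u' => forall e : gedge R, val e = (apex V, base u) ->
    val (phi e) = (apex V', base u'))) => u.
  have au : gadj R (apex V, base u) by apply: gadj_apex.
  have [x' Ex' tx'] := apex_image (erefl (val (Sub (apex V, base u) au : gedge R))).
  case: x' Ex' tx' => [[i|u']|[[v w] b]] Ex' //= tx'.
    by have := ltn_ord i; rewrite tx'.
  by exists u' => e Ee; rewrite -Ex'; congr (val (phi _)); apply: val_inj; exact: Ee.
have arcP u v : R u v -> R' (f u) (f v) /\
    forall b (e : gedge R), val e = (apex V, inner u v b) ->
      val (phi e) = (apex V', inner (f u) (f v) b).
  move=> uv.
  (* An inner vertex keeps its position [b], but the arc [p] could at first depend on [b]. *)
  have inn b : exists p, R' p.1 p.2 /\ forall (e : gedge R), val e = (apex V, inner u v b) ->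
      val (phi e) = (apex V', inner p.1 p.2 b).
    have ab : gadj R (apex V, inner u v b) by apply: gadj_apex => //; case: b.
    have [x' Ex' tx'] := apex_image (erefl (val (Sub (apex V, inner u v b) ab : gedge R))).
    case: x' Ex' tx' => [[i|u']|[[u' v'] b']] Ex' /= tx'.
    - by have := ltn_ord i; rewrite tx'; case: b {ab Ex' tx'}.
    - by case: b {ab Ex'} tx'.
    have bb : b' = b by case: b b' tx' {ab Ex'} => [] [].
    exists (u', v'); split.
      by have /and4P[_] := gadjP (phi (Sub (apex V, inner u v b) ab)); rewrite Ex'.
    by move=> e Ee; rewrite -bb -Ex'; congr (val (phi _)); apply: val_inj; exact: Ee.
  have [[u1 v1] [R1 in1]] := inn false; have [[u2 v2] [R2 in2]] := inn true.
  have a1 : gadj R (apex V, inner u v false) by apply: gadj_apex.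
  have a2 : gadj R (apex V, inner u v true) by apply: gadj_apex.
  have au : gadj R (apex V, base u) by apply: gadj_apex.
  have av : gadj R (apex V, base v) by apply: gadj_apex.
  have gu1 : gadj R (base u, inner u v false) by rewrite /gadj /= uv eqxx.
  have g12 : gadj R (inner u v false, inner u v true) by rewrite /gadj /= uv eqxx.
  have gv2 : gadj R (base v, inner u v true) by rewrite /gadj /= uv eqxx.
  have val_phi x y (xy : gadj R (x, y)) x' y' := @phi_val x y x' y' (Sub (x, y) xy).
  pose eu : gedge R := Sub _ au; pose ev : gedge R := Sub _ av.
  pose e1 : gedge R := Sub _ a1; pose e2 : gedge R := Sub _ a2.
  have := val_phi _ _ gu1 _ _ eu e1 erefl erefl erefl (fP u eu erefl) (in1 e1 erefl).
  have := val_phi _ _ g12 _ _ e1 e2 erefl erefl erefl (in1 e1 erefl) (in2 e2 erefl).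
  have := val_phi _ _ gv2 _ _ ev e2 erefl erefl erefl (fP v ev erefl) (in2 e2 erefl).
  (* The three path edges have edges as images; by [compatible], both inner images lie on the path
     of one arc, which runs from [f u] to [f v]. *)
  move=> /(congr1 (gadj R')) + /(congr1 (gadj R')) + /(congr1 (gadj R')).
  rewrite !gadjP => /esym/and4P[_ _ /= /eqP fv _] /esym/and4P[_ _ /= /eqP[uu vv] _].
  move=> /esym/and4P[_ _ /= /eqP fu _].
  rewrite fu fv; split; first by rewrite -vv.
  by move=> [] e Ee; [rewrite uu; apply: in2 | rewrite -vv; apply: in1].
have fR : {homo f : u v / R u v >-> R' u v} by move=> u v /arcP[].
have apexP x (e : gedge R) : val e = (apex V, x) -> val (phi e) = (apex V', gvert_map f x).
  move=> Ee; case: x Ee => [[i|u]|[[u v] b]] Ee; last first.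
  - by have /and4P[_ uv _ _] := gadjP e; rewrite Ee /= in uv; have [_] := arcP u v uv; apply.
  - exact: fP.
  have [x' -> tx'] := apex_image Ee; congr pair.
  rewrite [x']constantP tx' //= ?ltn_ord //.
  by rewrite /constant inord_val.
exists f, fR; apply/ffunP => e; rewrite ffunE; apply: val_inj.
case Ee: (val e) => [x y]; rewrite [RHS]/= Ee.
have /and4P[] := gadjP e; rewrite Ee /= => xok yok _ lxy.
have y0 : 0 < ty y by have /andP[/(leq_ltn_trans (leq0n _))] := lower_lt13 lxy.
have [x0|x0] := posnP (ty x).
  have xE : x = apex V by rewrite (constantP (x := x)) ?x0.
  by rewrite xE in Ee *; apply: apexP.
apply: (phi_val (ex := Sub (apex V, x) (gadj_apex xok x0))
  (ey := Sub (apex V, y) (gadj_apex yok y0)) Ee) => //; exact: apexP.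
Qed.

End Rigidity.

(** * Functoriality and faithfulness *)

Section Functoriality.
Variables (U V W : finType) (R : rel U) (S : rel V) (T : rel W).

Lemma gedge_map_id f (fR : {homo f : u v / R u v >-> R u v}) e :
  f =1 id -> gedge_map fR e = e.
Proof.
move=> fE; have mapE x : gvert_map f x = x.
  by case: x => [[i|u]|[[u v] b]] //=; rewrite !fE.
by apply: val_inj; rewrite /= !mapE -surjective_pairing.
Qed.

Lemma gedge_map_ext f g (fR : {homo f : u v / R u v >-> S u v})
    (gR : {homo g : u v / R u v >-> S u v}) e :
  f =1 g -> gedge_map fR e = gedge_map gR e.
Proof.
move=> fE; have mapE x : gvert_map f x = gvert_map g x.
  by case: x => [[i|u]|[[u v] b]] //=; rewrite !fE.
by apply: val_inj; rewrite /= !mapE.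
Qed.

Lemma gedge_map_comp f g h (fR : {homo f : u v / R u v >-> S u v})
    (gR : {homo g : u v / S u v >-> T u v}) (hR : {homo h : u v / R u v >-> T u v}) e :
  h =1 g \o f -> gedge_map hR e = gedge_map gR (gedge_map fR e).
Proof.
move=> hE; have mapE x : gvert_map h x = gvert_map g (gvert_map f x).
  by case: x => [[i|u]|[[u v] b]] //=; rewrite !hE.
by apply: val_inj; rewrite /= !mapE.
Qed.

(** The image of the edge from the apex to [base u] records [f u]. *)
Lemma gedge_map_inj f g (fR : {homo f : u v / R u v >-> S u v})
    (gR : {homo g : u v / R u v >-> S u v}) :
  [ffun e => gedge_map fR e] = [ffun e => gedge_map gR e] -> f =1 g.
Proof.
move=> fg u; have au : gadj R (apex U, base u) by apply: gadj_apex.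
by have /ffunP/(_ (Sub (apex U, base u) au)) := fg; rewrite !ffunE => -[].
Qed.

End Functoriality.

(** * Homomorphisms as maps preserving the arc relation *)

Section Directed.

Definition arc (G : digraph) (u v : vert G) : bool :=
  [exists e : edge G, (src e == u) && (tgt e == v)].

Lemma dhom_arc (G H : digraph) (f : dhom G H) :
  {homo f : u v / arc u v >-> arc u v}.
Proof.
move=> u v /existsP[e /andP[/eqP <- /eqP <-]].
exact: forallP (dhomP f) e.
Qed.

Lemma arc_dhom (G H : digraph) (f : vert G -> vert H) :
  {homo f : u v / arc u v >-> arc u v} -> is_dhom (finfun f).
Proof.
move=> fR; apply/forallP => e; rewrite !ffunE; apply: fR.
by apply/existsP; exists e; rewrite !eqxx.
Qed.

Definition gadget_dmap (G H : digraph) (f : dhom G H) :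
    {ffun edge (gadget (@arc G)) -> edge (gadget (@arc H))} :=
  [ffun e => gedge_map (dhom_arc f) e].

End Directed.

Section Undirected.

(** This relation is symmetric: an edge with two ends becomes two opposite arcs, each encoded by its
    own path. *)
Definition uarc (G : ugraph) (u v : uvert G) : bool :=
  [exists e : uedge G, uends e == [set u; v]].

Lemma uhom_uarc (G H : ugraph) (f : uhom G H) :
  {homo f : u v / uarc u v >-> uarc u v}.
Proof.
move=> u v /existsP[e /eqP eE]; have /existsP[e' /eqP e'E] := forallP (uhomP f) e.
by apply/existsP; exists e'; rewrite e'E eE imsetU1 imset_set1.
Qed.

Lemma uarc_uhom (G : loopless_ugraph) (H : ugraph) (f : uvert G -> uvert H) :
  {homo f : u v / uarc u v >-> uarc u v} -> is_uhom (finfun f).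
Proof.
move=> fR; apply/forallP => e.
have /cards2P[u [v [_ eE]]] := forallP (ulgraphP G) e.
have /fR/existsP[e' /eqP e'E] : uarc u v by apply/existsP; exists e; rewrite eE.
by apply/existsP; exists e'; rewrite e'E eE imsetU1 imset_set1 !ffunE.
Qed.

Lemma gadget_ends_card (V : finType) (R : rel V) (e : edge (gadget R)) : 0 < #|ends e| <= 2.
Proof. by rewrite cards2; case: (_ != _). Qed.

Definition ugadget (V : finType) (R : rel V) : ugraph := UGraph (@gadget_ends_card V R).

Lemma gadget_orientation (V : finType) (R : rel V) :
  @is_orientation (ugadget R) (@src (gadget R)) (@tgt (gadget R)).
Proof. by []. Qed.

Definition gadget_umap (G H : ugraph) (f : uhom G H) :
    {ffun uedge (ugadget (@uarc G)) -> uedge (ugadget (@uarc H))} :=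
  [ffun e : gedge _ => gedge_map (uhom_uarc f) e].

End Undirected.

Theorem theorem26 :
  (exists (F : loopless_digraph -> digraph)
          (Fmap : forall G H : loopless_digraph,
             dhom G H -> {ffun edge (F G) -> edge (F H)}),
     (forall G : loopless_digraph,
        Fmap G G (dhom_id G) = [ffun e => e]) /\
     (forall (G H K : loopless_digraph) (g : dhom H K) (f : dhom G H),
        Fmap G K (dhom_comp g f) = [ffun e => Fmap H K g (Fmap G H f e)]) /\
     (forall G H : loopless_digraph, injective (Fmap G H)) /\
     (forall (M : nzRingType) (G H : loopless_digraph),
        ((exists f : dhom G H, True) <->
         (exists phi : {ffun edge (F G) -> edge (F H)},
            tension_continuous M phi)) /\
        (forall f : dhom G H, tension_continuous M (Fmap G H f)) /\
        (forall phi : {ffun edge (F G) -> edge (F H)},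
           tension_continuous M phi -> exists f : dhom G H, phi = Fmap G H f)))
  /\
  (exists (F : loopless_ugraph -> ugraph)
          (Fmap : forall G H : loopless_ugraph,
             uhom G H -> {ffun uedge (F G) -> uedge (F H)}),
     (forall G : loopless_ugraph,
        Fmap G G (uhom_id G) = [ffun e => e]) /\
     (forall (G H K : loopless_ugraph) (g : uhom H K) (f : uhom G H),
        Fmap G K (uhom_comp g f) = [ffun e => Fmap H K g (Fmap G H f e)]) /\
     (forall G H : loopless_ugraph, injective (Fmap G H)) /\
     (forall (M : nzRingType) (G H : loopless_ugraph),
        ((exists f : uhom G H, True) <->
         (exists phi : {ffun uedge (F G) -> uedge (F H)},
            utension_continuous M phi)) /\
        (forall f : uhom G H, utension_continuous M (Fmap G H f)) /\
        (forall phi : {ffun uedge (F G) -> uedge (F H)},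
           utension_continuous M phi -> exists f : uhom G H, phi = Fmap G H f))).
Proof.
split.
  exists (fun G : loopless_digraph => gadget (@arc G)), (@gadget_dmap).
  split; [|split; [|split]].
  - by move=> G; apply/ffunP => e; rewrite !ffunE gedge_map_id // => u; rewrite ffunE.
  - move=> G H K g f; apply/ffunP => e; rewrite !ffunE.
    by apply: gedge_map_comp => u; rewrite ffunE.
  - move=> G H [f fP] [g gP] /gedge_map_inj /= fg.
    have {}fg : f = g by apply/ffunP.
    by subst g; rewrite (bool_irrelevance fP gP).
  move=> M G H.
  have continuous (f : dhom G H) : tension_continuous M (gadget_dmap f).
    exact: gedge_map_tension_continuous.
  have full phi : tension_continuous M phi -> exists f : dhom G H, phi = gadget_dmap f.
    move=> phiT.
    have [f [fR ->]] := tension_continuous_gedge_map (fun=> erefl) (fun=> erefl) phiT.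
    exists (DHom (arc_dhom fR)); apply/ffunP => e; rewrite !ffunE.
    by apply: gedge_map_ext => u; rewrite ffunE.
  split=> //; split; first by case=> f _; exists (gadget_dmap f).
  by case=> phi /full[f _]; exists f.
exists (fun G : loopless_ugraph => ugadget (@uarc G)), (@gadget_umap).
split; [|split; [|split]].
- by move=> G; apply/ffunP => e; rewrite !ffunE gedge_map_id // => u; rewrite ffunE.
- move=> G H K g f; apply/ffunP => e; rewrite !ffunE.
  by apply: gedge_map_comp => u; rewrite ffunE.
- move=> G H [f fP] [g gP] /gedge_map_inj /= fg.
  have {}fg : f = g by apply/ffunP.
  by subst g; rewrite (bool_irrelevance fP gP).
move=> M G H.
have continuous (f : uhom G H) : utension_continuous M (gadget_umap f).
  (* The witnessing orientations are those of the directed gadgets. *)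
  do 2![eexists; eexists]; split; [exact: gadget_orientation | exact: gadget_orientation |].
  exact: gedge_map_tension_continuous.
have full phi : utension_continuous M phi -> exists f : uhom G H, phi = gadget_umap f.
  case=> [s [t [s' [t' [sP s'P phiT]]]]].
  have [f [fR ->]] :=
    tension_continuous_gedge_map (fun e => esym (sP e)) (fun e => esym (s'P e)) phiT.
  exists (UHom (uarc_uhom fR)); apply/ffunP => e; rewrite !ffunE.
  by apply: gedge_map_ext => u; rewrite ffunE.
split=> //; split; first by case=> f _; exists (gadget_umap f).
by case=> phi /full[f _]; exists f.
Qed.
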